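(* For every infinite cardinal number $\kappa$ the following are equivalent: (1) $\kappa<\mathfrak{d}$. (2) For each $\mathsf{T}_1$ topological space $(X,\tau)$ without isolated points such that $\delta_{\theta}(X)=\aleph_0$ and $\pi_{\theta}(X)\le\kappa$, player ONE has no winning strategy in the game $\mathsf{G}_{fin}(\mathcal{D}_{\theta},\mathcal{D}_{\theta})$ played on $X$. (3) For each $\mathsf{T}_1$ topological space $(X,\tau)$ without isolated points such that $\delta_{\theta}(X)=\aleph_0$ and $\pi_{\theta}(X)\le\kappa$, the selection principle $\mathsf{S}_{fin}(\mathcal{D}_{\theta},\mathcal{D}_{\theta})$ holds for $X$.
   Context: All spaces are nonempty. $\mathfrak{d}$ is the dominating number: the least cardinality of a family $\mathcal{F}\subseteq{}^{\omega}\omega$ such that for every $g\in{}^{\omega}\omega$ there is $f\in\mathcal{F}$ with $g(n)\le f(n)$ for all but finitely many $n$. For a topological space $(X,\tau)$ and $A\subseteq X$, the $\theta$-closure of $A$ is $cl_{\theta}(A)=\{x\in X:\text{ for every neighborhood }U\text{ of }x,\ \overline{U}\cap A\neq\emptyset\}$, where $\overline{U}$ is the closure of $U$ in $\tau$. A set $D\subseteq X$ is $\theta$-dense if $cl_{\theta}(D)=X$. $\mathcal{D}_{\theta}$ denotes the family of all $\theta$-dense subsets of $X$. $\delta_{\theta}(X)$ is the least cardinal $\lambda\ge\aleph_0$ such that each $\theta$-dense $D\subseteq X$ contains a $\theta$-dense (in $X$) set $C\subseteq D$ with $|C|\le\lambda$. A family $\mathcal{V}$ of nonempty open subsets of $X$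 is a $\theta$-$\pi$-base for $X$ if for every nonempty open $U\subseteq X$ there is $V\in\mathcal{V}$ with $V\subseteq\overline{U}$. $\pi_{\theta}(X)$ is the least cardinality of a $\theta$-$\pi$-base for $X$. For families of sets $\mathcal{A}$, $\mathcal{B}$: $\mathsf{S}_{fin}(\mathcal{A},\mathcal{B})$ is the statement that for each sequence $(A_n:n<\omega)$ of elements of $\mathcal{A}$ there is a sequence $(B_n:n<\omega)$ such that each $B_n\subseteq A_n$ is finite and $\bigcup\{B_n:n<\omega\}\in\mathcal{B}$. The game $\mathsf{G}_{fin}(\mathcal{A},\mathcal{B})$ between players ONE and TWO has length $\omega$: in inning $n<\omega$ ONE chooses $O_n\in\mathcal{A}$ and TWO responds with a finite set $T_n\subseteq O_n$. TWO wins the play $O_0,T_0,O_1,T_1,\dots$ if $\bigcup\{T_n:n<\omega\}\in\mathcal{B}$; otherwise ONE wins. A strategy for a player is a function assigning to each finite sequence of previous moves of the opponent a legal next move; it is winning if the player wins every play in which the strategy is followed. *)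

(* Defs.v *)
(* A cardinal is represented by any type of that cardinality
   and compared with #<= and #= on full sets. *)
From HB Require Import structures.
From mathcomp Require Import all_boot all_order.
From mathcomp Require Import boolp classical_sets functions cardinality.
From mathcomp Require Import filter topology.

Set Implicit Arguments.
Unset Strict Implicit.
Unset Printing Implicit Defensive.

Local Open Scope classical_set_scope.
Local Open Scope card_scope.

Definition cardinal_le (K L : Type) : Prop := [set: K] #<= [set: L].

Definition cardinal_lt (K L : Type) : Prop :=
  cardinal_le K L /\ ~ cardinal_le L K.

(* A maximal set of choice functions on which every projection is injective
   must project onto some member of the family. *)
Lemma family_least (I : Type) (A : I -> Type) (i0 : I) :
  exists i, forall j, cardinal_le (A i) (A j).
Proof.
pose T := forall i : I, A i.
pose Q (S : set T) := forall i : I, {in S &, injective (fun t : T => t i)}.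
have [F FS tF|S [QS Smax]] := @Zorn_bigcup T Q.
  move=> i x y /set_mem[B FB Bx] /set_mem[C FC Cy].
  have [BC|CB] := tF _ _ FB FC.
    by apply: (FS _ FC i); apply/mem_set => //; exact: BC.
  by apply: (FS _ FB i); apply/mem_set => //; exact: CB.
have [[i surj_i]|/forallNP nsurj] :=
    pselect (exists i, forall z : A i, exists2 t, S t & t i = z).
  exists i => j.
  pose g (z : A i) : T := s2val (cid2 (surj_i z)).
  have gS z : S (g z) by rewrite /g; case: (cid2 _).
  have gK z : g z i = z by rewrite /g; case: (cid2 _).
  have h_inj : injective (fun z => g z j).
    move=> z z' /= e; rewrite -(gK z) -(gK z').
    by rewrite (QS j _ _ (mem_set (gS z)) (mem_set (gS z')) e).
  rewrite /cardinal_le -(card_le_eql (inj_card_eq (in2W h_inj))).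
  exact/subset_card_le/subsetT.
have miss i : exists z : A i, forall t, S t -> t i <> z.
  have /existsNP[z nz] := nsurj i; exists z => t St tz.
  by apply: nz; exists t.
pose t0 : T := fun i => sval (cid (miss i)).
have t0P i t : S t -> t i <> t0 i by rewrite /t0; case: cid => z /= h /h.
have St0 : ~ S t0 by move=> /(t0P i0).
exfalso; apply: (Smax (S `|` [set t0])).
  by split; [move=> t; left | move=> /(_ t0 (or_intror erefl))].
move=> i x y /set_mem[Sx|->] /set_mem[Sy|->] //= e.
- by apply: (QS i); rewrite ?inE.
- by case: (t0P i _ Sx).
- by case: (t0P i _ Sy).
Qed.

Lemma cardinal_le_total (K L : Type) : cardinal_le K L \/ cardinal_le L K.
Proof.
have [[] h] := @family_least bool (fun b => if b then K else L) true.
- by left; exact: (h false).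
- by right; exact: (h true).
Qed.

(* [L] has the least cardinality among the types satisfying [P]. For [P]
   invariant under bijection it exists as soon as [P] holds somewhere, and it is
   unique up to bijection. *)
Definition least_cardinal (P : Type -> Prop) (L : Type) : Prop :=
  P L /\ forall L' : Type, P L' -> cardinal_le L L'.

Lemma least_cardinal_unique (P : Type -> Prop) (L L' : Type) :
  least_cardinal P L -> least_cardinal P L' -> [set: L] #= [set: L'].
Proof.
move=> [PL minL] [PL' minL'].
by apply: Cantor_Bernstein; [exact: minL | exact: minL'].
Qed.

(* Indexing by the subsets of [L0], rather than by all types satisfying [P],
   avoids putting [L0] in a strictly smaller universe than the library types. *)
Lemma least_cardinal_exists (P : Type -> Prop) (L0 : Type) :
  (forall L L' : Type, [set: L] #= [set: L'] -> P L -> P L') ->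
  P L0 -> exists L : Type, least_cardinal P L.
Proof.
move=> Pinv PL0.
have PT : P (set_type [set: L0]).
  by apply: Pinv PL0; rewrite card_eq_sym card_setT.
pose I := {A : set L0 | P (set_type A)}.
pose iT : I := exist _ [set: L0] PT.
have [i le_i] := @family_least I (fun i => set_type (sval i)) iT.
exists (set_type (sval i)); split; first exact: (svalP i).
move=> L' PL'; have [|L0L'] := cardinal_le_total L' L0.
  move=> /card_subP[A AL' _].
  have L'tA : [set: L'] #= [set: set_type A].
    by apply: card_eq_trans (card_esym AL') _; rewrite card_eq_sym card_setT.
  rewrite /cardinal_le (card_le_eqr L'tA).
  exact: (le_i (exist _ A (Pinv _ _ L'tA PL'))).
apply: card_le_trans (le_i iT) _.
by rewrite (card_le_eql (card_setT _)).
Qed.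

Definition dominating (F : set (nat -> nat)) : Prop :=
  forall g : nat -> nat, exists2 f, F f & \forall n \near \oo, (g n <= f n)%N.

Definition is_dominating_number : Type -> Prop :=
  least_cardinal (fun L => exists2 F, dominating F & F #= [set: L]).

Section Theta.
Context {X : topologicalType}.
Implicit Types (A D : set X) (V : set (set X)).

Definition theta_closure A : set X :=
  [set x | forall U, nbhs x U -> closure U `&` A !=set0].

Definition theta_dense D : Prop := theta_closure D = [set: X].

Definition theta_dense_sets : set (set X) := [set D | theta_dense D].

Definition theta_pi_base V : Prop :=
  (forall W, V W -> open W /\ W !=set0) /\
  forall U, open U -> U !=set0 -> exists2 W, V W & W `<=` closure U.

End Theta.

Definition is_delta_theta (X : topologicalType) : Type -> Prop :=
  least_cardinal (fun L => cardinal_le nat L /\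
    forall D : set X, theta_dense D ->
      exists C : set X, [/\ C `<=` D, theta_dense C & C #<= [set: L]]).

Definition is_pi_theta (X : topologicalType) : Type -> Prop :=
  least_cardinal (fun L =>
    exists2 V : set (set X), theta_pi_base V & V #= [set: L]).

Section Selection.
Context {X : Type}.
Implicit Types (A B : set (set X)).

Definition S_fin A B : Prop :=
  forall O : nat -> set X, (forall n, A (O n)) ->
  exists T : nat -> set X,
    (forall n, finite_set (T n) /\ T n `<=` O n) /\ B (\bigcup_n T n).

(* A strategy [s] of ONE maps TWO's previous moves, oldest first, to the next
   move of ONE; [TWO_moves s h] says that [h] is a sequence of legal moves of
   TWO against [s]. *)
Definition TWO_moves (s : seq (set X) -> set X) (h : seq (set X)) : Prop :=
  forall i, (i < size h)%N ->
    finite_set (nth set0 h i) /\ nth set0 h i `<=` s (take i h).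

Definition ONE_strategy A (s : seq (set X) -> set X) : Prop :=
  forall h, TWO_moves s h -> A (s h).

Definition ONE_winning_strategy A B (s : seq (set X) -> set X) : Prop :=
  ONE_strategy A s /\
  forall T : nat -> set X,
    (forall n, finite_set (T n) /\ T n `<=` s (mkseq T n)) ->
    ~ B (\bigcup_n T n).

Definition ONE_wins_G_fin A B : Prop :=
  exists s, ONE_winning_strategy A B s.

End Selection.

(* Main.v *)
Require Import Defs.
From HB Require Import structures.
From mathcomp Require Import all_boot all_order.
From mathcomp Require Import boolp classical_sets functions cardinality.
From mathcomp Require Import filter topology.

Local Open Scope classical_set_scope.
Local Open Scope card_scope.

(** Suppose kappa < d, and let ONE follow a strategy. Since delta_theta is
    countable, each theta-dense move of ONE contains a countable theta-dense
    set, hence an increasing sequence of finite sets whose union is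
    theta-dense; let TWO answer with a term of that sequence. TWO's plays are
    then coded by functions g : nat -> nat, and the position reached after n
    innings by the word g 0, ..., g (n-1). For a member V of a
    theta-pi-base and a word u, let F V u be the index from which the finite
    sets offered after u meet the closure of V. The play coded by g is won by
    TWO as soon as, for every V, some n has F V (g restricted to n) <= g n. For
    a fixed V the functions g violating this form a finitely branching tree,
    so they are bounded by a single function h V (bounded_paths); at most kappa
    functions h V do not dominate, and any g escaping all of them
    beats the strategy (path_catching, ONE_no_winning_strategy).

    The game statement implies the selection principle because a sequence of
    sets is a strategy that looks only at the inning number.

    Conversely, let d <= kappa. The finite words over nat carry a topology in
    which a neighborhood of p contains, for some f : nat -> nat, the
    cone of all extensions q of p whose new letters satisfy f n <= q_n. The
    space is countable, T1 and without isolated points. For a dominating family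
    F the cones given by members of F form a theta-pi-base: eventual
    domination suffices, since one may first lengthen p inside a cone until the
    domination has begun. There are |F| * aleph_0 <= kappa such cones, where the
    inequality is cardinal_mul_nat. The words of length > n are dense, but if
    T n is a finite set of such words and f n exceeds the n-th letter of each
    of them, then the closure of the cone of f at the empty word misses every
    T n. So the selection principle fails for this space. *)

(** * Cardinal arithmetic *)

Lemma cardinal_leP (K L : Type) :
  cardinal_le K L <-> exists f : K -> L, injective f.
Proof.
split=> [/card_leP[f]|[f f_inj]]; last first.
  rewrite /cardinal_le -(card_le_eql (inj_card_eq (in2W f_inj))).
  exact/subset_card_le/subsetT.
exists (fun x => set_val (f (SigSub (mem_set (I : [set: K] x))))) => x y.
move=> /val_inj /(@inj _ _ _ f) e.
by have /(congr1 set_val) := e (mem_set I) (mem_set I).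
Qed.

Lemma cardinal_le_trans (K L M : Type) :
  cardinal_le K L -> cardinal_le L M -> cardinal_le K M.
Proof. exact: card_le_trans. Qed.

Lemma cardinal_le_setT_image (I T : Type) (f : I -> T) :
  cardinal_le (set_type (range f)) I.
Proof.
rewrite /cardinal_le (card_le_eql (card_setT _)); exact: card_image_le.
Qed.

(** A maximal family of injective sequences with pairwise disjoint ranges leaves
    out only finitely many points, since an infinite remainder would contain
    one more sequence. Injectivity of the evaluation map on S * nat expresses
    injectivity and disjointness at once. *)
Lemma infinite_disjoint_sequences {K : Type} :
  infinite_set [set: K] ->
  exists S : set (nat -> K), [/\ S !=set0,
    {in [set p : (nat -> K) * nat | S p.1] &,
      injective (fun p => p.1 p.2)} &
    finite_set (~` [set x | exists2 e, S e & exists n, e n = x])].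
Proof.
move=> Kinf.
pose Q (S : set (nat -> K)) := {in [set p : (nat -> K) * nat | S p.1] &,
      injective (fun p => p.1 p.2)}.
have [F FQ tF|S [QS Smax]] := @Zorn_bigcup (nat -> K) Q.
  move=> p q /set_mem[B FB Bp] /set_mem[C FC Cq].
  have [BC|CB] := tF _ _ FB FC.
    by apply: (FQ _ FC); apply/mem_set => //; exact: BC.
  by apply: (FQ _ FB); apply/mem_set => //; exact: CB.
have fin : finite_set (~` [set x | exists2 e, S e & exists n, e n = x]).
  apply/finite_setPn => /card_leP[f].
  pose a n : K := set_val (f (SigSub (mem_set (I : [set: nat] n)))).
  have a_out n : ~ exists2 e, S e & exists m, e m = a n.
    exact: (set_mem (valP (f (SigSub (mem_set (I : [set: nat] n)))))).
  have a_inj : injective a.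
    move=> m n /val_inj /(@inj _ _ _ f) e.
    by have /(congr1 set_val) := e (mem_set I) (mem_set I).
  apply: (Smax (S `|` [set a])).
    split; first by move=> t; left.
    move=> /(_ a (or_intror erefl)) Sa.
    by apply: (a_out 0); exists a => //; exists 0.
  move=> [e m] [e' m'] /set_mem[Se|/= ->] /set_mem[Se'|/= ->].
  - by apply: QS; apply/mem_set.
  - by move=> em; case: (a_out m'); exists e => //; exists m.
  - by move=> em; case: (a_out m); exists e' => //; exists m'.
  - by move=> /a_inj ->.
exists S; split=> //.
apply: contrapT => /set0P/negP/negPn/eqP S0; apply: Kinf.
apply: sub_finite_set fin => x _ [e]; by rewrite S0.
Qed.

(** The disjoint sequences identify K with S * nat up to a finite set, and
    S * nat absorbs both that set and another factor nat. *)
Lemma cardinal_mul_nat (K : Type) :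
  infinite_set [set: K] -> cardinal_le (K * nat) K.
Proof.
move=> /infinite_disjoint_sequences[S [[e0 Se0] S_inj fin]].
pose R := ~` [set x | exists2 e, S e & exists n, e n = x].
have /countable_injP[r r_inj] : countable R by exact: finite_set_countable.
have K_le : cardinal_le K (set_type S * nat).
  (* A point is found either on a sequence of S or in the remainder R, whose
     points are placed on the fixed sequence e0. *)
  pose pos (x : K) (q : set_type S * (nat + nat)) := match q.2 with
    | inl n => set_val q.1 n = x
    | inr n => R x /\ r x = n end.
  have /choice[c cP] x : exists q, pos x q.
    have [[e Se [n en]]|Rx] :=
        pselect ([set x | exists2 e, S e & exists n, e n = x] x).
      by exists (SigSub (mem_set Se), inl n); rewrite /pos.
    by exists (SigSub (mem_set Se0), inr (r x)).
  apply/cardinal_leP; exists (fun x => ((c x).1, pickle (c x).2)) => x y.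
  move=> [e1 /(pcan_inj pickleK) e2]; have := cP x; have := cP y.
  rewrite /pos e1 e2; case: (c y).2 => n; first by move=> -> ->.
  by move=> [Ry ry] [Rx rx]; apply: r_inj; rewrite ?inE // rx ry.
apply: (@cardinal_le_trans _ ((set_type S * nat) * nat)).
  have /cardinal_leP[f f_inj] := K_le.
  apply/cardinal_leP; exists (fun p => (f p.1, p.2)).
  by move=> [x m] [y n] /= [/f_inj -> ->].
apply/cardinal_leP.
exists (fun p => set_val p.1.1 (pickle (p.1.2, p.2))).
move=> [[e m] n] [[e' m'] n'] /= ee'.
have inS (u : set_type S) k :
    (set_val u, k) \in [set p : (nat -> K) * nat | S p.1].
  by apply/mem_set => /=; exact: set_valP.
have := S_inj (set_val e, pickle (m, n)) (set_val e', pickle (m', n')).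
by move=> /(_ (inS _ _) (inS _ _) ee')[/val_inj -> /(pcan_inj pickleK)[-> ->]].
Qed.

(** * Functions not dominated by a small family *)

Lemma dominating_number_exists : exists d : Type, is_dominating_number d.
Proof.
apply: (@least_cardinal_exists _ (set_type [set: nat -> nat])).
  by move=> L L' LL' [F F_dom FL]; exists F => //; exact: card_eq_trans LL'.
exists [set: nat -> nat]; last by rewrite card_eq_sym card_setT.
by move=> g; exists g => //; exists 0.
Qed.

Lemma not_dominated_small {d K I : Type} (h : I -> nat -> nat) :
  is_dominating_number d -> cardinal_lt K d -> cardinal_le I K ->
  exists g : nat -> nat, forall i, exists n, (h i n < g n)%N.
Proof.
move=> [_ d_min] [_ not_dK] IK; apply: contrapT => /forallNP bad.
apply: not_dK; apply: cardinal_le_trans IK.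
apply: cardinal_le_trans (cardinal_le_setT_image _ _ h).
apply: d_min; exists (range h); last by rewrite card_eq_sym card_setT.
move=> g; have /existsNP[i /forallNP hi] := bad g.
by exists (h i); [exists i | exists 0 => // n _ /=; rewrite leqNgt; apply/negP].
Qed.

(** The words all of whose letters respect the bound F are finitely many at
    each length, by the argument of Koenig's lemma. *)
Lemma bounded_paths (F : seq nat -> nat) :
  exists h : nat -> nat, forall g : nat -> nat,
    (forall n, g n < F (mkseq g n))%N -> forall n, (g n <= h n)%N.
Proof.
(* L n lists the words of length n whose letters respect F. *)
pose L := fix L n := if n is n.+1 then
  [seq rcons u k | u <- L n, k <- iota 0 (F u)] else [:: [::]].
exists (fun n => \max_(u <- L n) F u) => g gF n.
have gL : mkseq g n \in L n.
  elim: n => //= n IHn; rewrite mkseqS.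
  apply/allpairsPdep; exists (mkseq g n), (g n).
  by split; rewrite ?mem_iota ?add0n ?gF.
exact: leq_trans (ltnW (gF n)) (leq_bigmax_seq _ gL isT).
Qed.

(** The form in which kappa < d enters the game: F i u is the answer that TWO
    needs at the position u to meet the i-th requirement, and the play g
    meets each requirement in some inning. *)
Lemma path_catching {d K I : Type} (F : I -> seq nat -> nat) :
  is_dominating_number d -> cardinal_lt K d -> cardinal_le I K ->
  exists g : nat -> nat, forall i, exists n, (F i (mkseq g n) <= g n)%N.
Proof.
move=> d_num Kd IK; have [h hP] := choice (fun i => bounded_paths (F i)).
have [g g_esc] := not_dominated_small h d_num Kd IK.
exists g => i; apply: contrapT => /forallNP low.
have [n] := g_esc i; rewrite ltnNge => /negP; apply; apply: hP => m.
by rewrite ltnNge; apply/negP/low.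
Qed.

(** * The game *)

Lemma theta_denseP (X : topologicalType) (D : set X) :
  theta_dense D <->
  forall U : set X, open U -> U !=set0 -> closure U `&` D !=set0.
Proof.
split=> [Dd U oU [x Ux]|Dd].
  have : theta_closure D x by rewrite (Dd : theta_closure D = _).
  by apply; exact: open_nbhs_nbhs.
apply/seteqP; split=> // x _ U; rewrite nbhsE => -[V [oV Vx] VU].
have [y [clVy Dy]] := Dd V oV (ex_intro _ x Vx).
by exists y; split=> //; exact: closureS clVy.
Qed.

Lemma theta_denseS (X : topologicalType) (D E : set X) :
  D `<=` E -> theta_dense D -> theta_dense E.
Proof.
move=> DE /theta_denseP Dd; apply/theta_denseP => U oU U0.
by have [x [clUx Dx]] := Dd U oU U0; exists x; split=> //; exact: DE.
Qed.

(** The answers among which TWO chooses. Monotonicity makes any answer at least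
    as large as the needed one good enough. *)
Definition finite_exhaustion {X : topologicalType} (D : set X)
    (e : nat -> set X) : Prop :=
  [/\ forall k, finite_set (e k) /\ e k `<=` D,
      forall j k, (j <= k)%N -> e j `<=` e k &
      theta_dense (\bigcup_k e k)].

Lemma finite_exhaustion_exists {X : topologicalType} (D : set X) :
  is_delta_theta X nat -> theta_dense D ->
  exists e, finite_exhaustion D e.
Proof.
move=> [[_ sep] _] /sep[C [CD Cdense /countable_injP[f f_inj]]].
exists (fun k => C `&` [set x | (f x <= k)%N]); split.
- move=> k; split; last by move=> x [/CD].
  apply/finite_set_leP; exists k.+1.
  set A := C `&` _.
  have fA : {in A &, injective f}.
    by move=> x y /set_mem[Cx _] /set_mem[Cy _]; apply: f_inj; apply/mem_set.
  rewrite -(card_le_eql (inj_card_eq fA)).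
  by apply: subset_card_le => _ [x [_ /= fx] <-].
- by move=> j k jk x [Cx /= fx]; split=> //; exact: leq_trans jk.
- apply: theta_denseS Cdense => x Cx.
  by exists (f x) => //; split=> /=.
Qed.

Lemma TWO_moves_rcons {X : Type} (s : seq (set X) -> set X) h (t : set X) :
  TWO_moves s h -> finite_set t -> t `<=` s h -> TWO_moves s (rcons h t).
Proof.
move=> hP t_fin ts i; rewrite size_rcons ltnS leq_eqVlt nth_rcons.
case/orP=> [/eqP->|ih].
  by rewrite ltnn eqxx -cats1 take_size_cat.
by rewrite ih -cats1 takel_cat ?(ltnW ih)//; exact: hP.
Qed.

(** Against a strategy of ONE, catching all requirements indexed by a
    theta-pi-base along one path gives TWO a winning play. *)
Lemma ONE_no_winning_strategy {d K : Type} {X : topologicalType} :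
  is_dominating_number d -> cardinal_lt K d -> is_delta_theta X nat ->
  (exists p : Type, is_pi_theta X p /\ cardinal_le p K) ->
  ~ ONE_wins_G_fin (@theta_dense_sets X) (@theta_dense_sets X).
Proof.
move=> d_num Kd sep [p [[[V [V_open V_base] Vp] _] pK]] [s [s_strat s_win]].
have /choice[e eP] h :
    exists e, theta_dense (s h) -> finite_exhaustion (s h) e.
  have [/(finite_exhaustion_exists _ sep)[e eP]|nd] :=
      pselect (theta_dense (s h)); first by exists e.
  by exists (fun=> set0) => /nd.
(* hist u lists the moves of TWO when the letters of u are the indices of the
   successive answers. *)
pose hist : seq nat -> seq (set X) := foldl (fun h k => rcons h (e h k)) [::].
have hist_rcons u k : hist (rcons u k) = rcons (hist u) (e (hist u) k).
  exact: foldl_rcons.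
have hist_legal u : TWO_moves s (hist u).
  elim/last_ind: u => // u k IHu; rewrite hist_rcons.
  have [ek _ _] := eP _ (s_strat _ IHu).
  by apply: TWO_moves_rcons => //; have [] := ek k.
have exh u : finite_exhaustion (s (hist u)) (e (hist u)).
  by apply: eP; exact: s_strat.
have /choice[F FP] (W : set_type V) : exists F : seq nat -> nat, forall u,
    closure (set_val W) `&` e (hist u) (F u) !=set0.
  have [oW W0] := V_open _ (set_valP W).
  have /choice[f fP] u :
      exists k, (closure (set_val W) `&` e (hist u) k) !=set0.
    have [_ _ /theta_denseP eu] := exh u.
    by have [x [Wx [k _ ekx]]] := eu _ oW W0; exists k, x.
  by exists f.
have VK : cardinal_le (set_type V) K.
  by rewrite /cardinal_le (card_le_eql (card_setT _)) (card_le_eql Vp).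
have [g gP] := path_catching F d_num Kd VK.
pose T n := e (hist (mkseq g n)) (g n).
have histT n : mkseq T n = hist (mkseq g n).
  by elim: n => // n IHn; rewrite !mkseqS hist_rcons IHn.
apply: (s_win T).
  by move=> n; rewrite histT; have [/(_ (g n))] := exh (mkseq g n).
apply/theta_denseP => U oU U0; have [W VW WU] := V_base U oU U0.
have [n Fn] := gP (SigSub (mem_set VW)).
have [x [clWx ex]] := FP (SigSub (mem_set VW)) (mkseq g n).
exists x; split.
  rewrite (iffLR (closure_id (closure U)) (@closed_closure _ U)).
  exact: closureS clWx.
by exists n => //; have [_ /(_ _ _ Fn) + _] := exh (mkseq g n); apply.
Qed.

Lemma S_fin_of_no_winning_strategy {X : Type} (A B : set (set X)) :
  ~ ONE_wins_G_fin A B -> S_fin A B.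
Proof.
move=> no_win O AO; apply: contrapT => /forallNP no_sel; apply: no_win.
exists (fun h => O (size h)); split=> [h _|T]; first exact: AO.
move=> TP BT; apply: (no_sel T); split=> // n.
by have := TP n; rewrite size_mkseq.
Qed.

(** * The space of finite words *)

(** A copy of the type of words, so that the topology below is attached to this
    name only. *)
Definition branching : Type := seq nat.

HB.instance Definition _ := Countable.on branching.

(** The bound f is tested only on the letters of q after p, so that p itself
    belongs to each of its cones. *)
Definition cone (p : branching) (f : nat -> nat) : set branching :=
  [set q | prefix p q /\
           forall n, (size p <= n < size q)%N -> (f n <= nth 0 q n)%N].

Definition cone_open (O : set branching) : Prop :=
  forall p, O p -> exists f, cone p f `<=` O.

Lemma cone_openT : cone_open setT.
Proof. by move=> p _; exists (fun=> 0). Qed.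

Lemma cone_openI : setI_closed cone_open.
Proof.
move=> A B oA oB p [/oA[f fA] /oB[g gB]].
exists (fun n => maxn (f n) (g n)) => q [pq qfg]; split.
  by apply: fA; split=> // n /qfg; rewrite geq_max => /andP[].
by apply: gB; split=> // n /qfg; rewrite geq_max => /andP[].
Qed.

Lemma cone_open_bigU (I : Type) (O : I -> set branching) :
  (forall i, cone_open (O i)) -> cone_open (\bigcup_i O i).
Proof.
move=> oO p [i _ Oip]; have [f fO] := oO i p Oip.
by exists f => q /fO; exists i.
Qed.

HB.instance Definition _ :=
  isOpenTopological.Build branching cone_openT cone_openI cone_open_bigU.

Lemma openP (O : set branching) : open O <-> cone_open O.
Proof. by []. Qed.

Lemma nth_prefix (p q : seq nat) n :
  prefix p q -> (n < size p)%N -> nth 0 q n = nth 0 p n.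
Proof. by move=> /prefixP[r ->] np; rewrite nth_cat np. Qed.

Lemma cone_center p f : cone p f p.
Proof.
split=> [|n /andP[/leq_ltn_trans/[apply]]]; first exact: prefix_refl.
by rewrite ltnn.
Qed.

Lemma cone_sub p f g q :
  cone p f q -> (forall n, (size q <= n)%N -> (f n <= g n)%N) ->
  cone q g `<=` cone p f.
Proof.
move=> [pq qf] fg r [qr rg]; split; first exact: prefix_trans qr.
move=> n /andP[pn nr]; have [nq|qn] := ltnP n (size q).
  by rewrite (nth_prefix _ _ _ qr nq) qf ?pn.
by apply: leq_trans (fg n qn) _; rewrite rg ?qn.
Qed.

Lemma open_cone p f : open (cone p f).
Proof. by apply/openP => q /cone_sub qP; exists f; exact: qP. Qed.

Lemma cone_long p f N : exists2 q, cone p f q & (N < size q)%N.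
Proof.
exists (p ++ mkseq (fun i => f (size p + i)) N.+1); last first.
  by rewrite size_cat size_mkseq ltn_addl.
split=> [|n]; first exact: prefix_prefix.
rewrite size_cat size_mkseq => /andP[pn nN].
by rewrite nth_cat ltnNge pn nth_mkseq ?subnKC // ltn_subLR.
Qed.

Lemma open_long (U : set branching) N :
  open U -> U !=set0 -> exists2 q, U q & (N < size q)%N.
Proof.
move=> /openP oU [p /oU[f fU]]; have [q /fU Uq Nq] := cone_long p f N.
by exists q.
Qed.

(** A point q different from p is avoided by the cone at p that asks for letters
    larger than those of q. *)
Lemma branching_accessible : accessible_space branching.
Proof.
move=> p q /eqP pq; exists (cone p (fun n => (nth 0 q n).+1)); split.
- exact: open_cone.
- by apply/mem_set; exact: cone_center.
apply/mem_set => -[/[dup]/size_prefix ple /prefixP[r qr] big].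
have [lt|ge] := ltnP (size p) (size q).
  by have := big (size p); rewrite leqnn lt ltnn => /(_ isT).
apply: pq; move: ge; rewrite qr size_cat -[leqRHS]addn0 leq_add2l leqn0.
by move=> /nilP ->; rewrite cats0.
Qed.

Lemma branching_no_isolated : isolated [set: branching] = set0.
Proof.
rewrite -subset0 => p [_ [V]]; rewrite nbhsE setIT => -[U [oU Up] UV] Vp.
have [q Uq pq] := open_long U (size p) oU (ex_intro _ p Up).
have : V q by exact: UV.
by rewrite Vp => /= qp; move: pq; rewrite qp ltnn.
Qed.

Lemma branching_delta_theta : is_delta_theta branching nat.
Proof.
split=> [|L [//]]; split=> [|D Dd]; first exact: card_lexx.
by exists D; split=> //; exact: countableP.
Qed.

(** Inside the cone of f at p, choose q longer than the place N from which on a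
    member g of F bounds f; then the cone of g at q lies in that of f at p. *)
Lemma cone_theta_pi_base (F : set (nat -> nat)) :
  dominating F ->
  theta_pi_base
    (range (fun a : set_type F * branching => cone a.2 (set_val a.1))).
Proof.
move=> F_dom; split=> [_ [[f p] _ <-]|U /openP oU [p Up]].
  by split; [exact: open_cone|exists p; exact: cone_center].
have [f fU] := oU p Up; have [g Fg [N _ fg]] := F_dom f.
have [q pq Nq] := cone_long p f N.
exists (cone q g); first by exists (SigSub (mem_set Fg), q).
apply: (subset_trans _ (@subset_closure _ _)).
apply: subset_trans fU; apply: cone_sub => // n qn.
by apply: fg => /=; exact: leq_trans (ltnW Nq) qn.
Qed.

Lemma branching_pi_theta (K : Type) (F : set (nat -> nat)) :
  infinite_set [set: K] -> dominating F -> cardinal_le (set_type F) K ->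
  exists p : Type, is_pi_theta branching p /\ cardinal_le p K.
Proof.
move=> Kinf F_dom FK; have VB := cone_theta_pi_base F F_dom.
set V := (X in theta_pi_base X) in VB.
have [p [pP p_min]] : exists p, is_pi_theta branching p.
  apply: (@least_cardinal_exists _ (set_type V)); last first.
    by exists V => //; rewrite card_eq_sym card_setT.
  move=> L L' LL' [W WB WL]; exists W => //; exact: card_eq_trans LL'.
exists p; split=> //; apply: cardinal_le_trans (cardinal_mul_nat K Kinf).
apply: (@cardinal_le_trans _ (set_type V)).
  by apply: p_min; exists V => //; rewrite card_eq_sym card_setT.
apply: cardinal_le_trans (cardinal_le_setT_image _ _ _) _.
have /cardinal_leP[j j_inj] := FK; apply/cardinal_leP.
exists (fun a => (j a.1, pickle a.2)) => -[f q] [f' q'] /=.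
by move=> [/j_inj -> /(pcan_inj pickleK) ->].
Qed.

Lemma theta_dense_long n : theta_dense [set q : branching | (n < size q)%N].
Proof.
apply/theta_denseP => U oU U0; have [q Uq nq] := open_long U n oU U0.
by exists q; split=> //; exact: subset_closure.
Qed.

(** Extensions of q keep the small n-th letter of q, so the cone of the zero
    bound at q is a neighborhood of q disjoint from the cone of f. *)
Lemma cone_closure_avoid f n (q : branching) :
  (n < size q)%N -> (nth 0 q n < f n)%N -> ~ closure (cone [::] f) q.
Proof.
move=> nq qf /(_ (cone q (fun=> 0))) [].
  by apply: open_nbhs_nbhs; split; [exact: open_cone|exact: cone_center].
move=> r [[_ rf] [qr _]].
have := rf n (leq_trans nq (size_prefix qr)).
by rewrite (nth_prefix _ _ _ qr nq) leqNgt qf.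
Qed.

(** Finite subsets T n of the set of words of length > n have bounded n-th
    letters; a function f beyond these bounds yields an open set whose closure
    misses every T n. *)
Lemma branching_not_S_fin :
  ~ S_fin (@theta_dense_sets branching) (@theta_dense_sets branching).
Proof.
move=> /(_ (fun n => [set q | (n < size q)%N]) theta_dense_long).
move=> [T [TP /theta_denseP Td]].
have /choice[f fP] n : exists m, forall q, T n q -> (nth 0 q n < m)%N.
  have [/finite_seqP[l lT] _] := TP n.
  exists (\max_(q <- l) nth 0 q n).+1 => q; rewrite lT /= => ql.
  by rewrite ltnS (leq_bigmax_seq q).
have [] := Td (cone [::] f); first exact: open_cone.
  by exists [::]; exact: cone_center.
move=> q [+ [n _ Tnq]]; apply: (@cone_closure_avoid _ n); last exact: fP.
by have [_] := TP n; apply.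
Qed.

(** * The equivalence *)

Theorem theorem5p6 (K : Type) (K_infinite : infinite_set [set: K]) :
  let kappa_lt_d :=
    exists d : Type, is_dominating_number d /\ cardinal_lt K d in
  let game_statement :=
    forall X : topologicalType,
      [set: X] !=set0 ->
      accessible_space X ->
      isolated [set: X] = set0 ->
      is_delta_theta X nat ->
      (exists p : Type, is_pi_theta X p /\ cardinal_le p K) ->
      ~ ONE_wins_G_fin (@theta_dense_sets X) (@theta_dense_sets X) in
  let selection_statement :=
    forall X : topologicalType,
      [set: X] !=set0 ->
      accessible_space X ->
      isolated [set: X] = set0 ->
      is_delta_theta X nat ->
      (exists p : Type, is_pi_theta X p /\ cardinal_le p K) ->
      S_fin (@theta_dense_sets X) (@theta_dense_sets X) in
  (kappa_lt_d <-> game_statement) /\ (game_statement <-> selection_statement).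
Proof.
move=> kappa_lt_d game_statement selection_statement.
have lt_game : kappa_lt_d -> game_statement.
  by move=> [d [d_num Kd]] X _ _ _; exact: (ONE_no_winning_strategy d_num Kd).
have game_sel : game_statement -> selection_statement.
  move=> game X X0 T1 iso sep pi; apply: S_fin_of_no_winning_strategy.
  exact: game.
suff sel_lt : selection_statement -> kappa_lt_d.
  split; split=> //.
  - by move=> game; exact: sel_lt (game_sel game).
  - by move=> sel; exact: lt_game (sel_lt sel).
move=> sel; have [d d_num] := dominating_number_exists.
exists d; split=> //; apply: contrapT => not_lt.
have dK : cardinal_le d K.
  have [Kd|//] := cardinal_le_total K d.
  by apply: contrapT => not_dK; apply: not_lt.
have [[F F_dom Fd] _] := d_num.
apply: branching_not_S_fin; apply: sel.
- by exists [::].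
- exact: branching_accessible.
- exact: branching_no_isolated.
- exact: branching_delta_theta.
apply: (branching_pi_theta _ F) => //.
by rewrite /cardinal_le (card_le_eql (card_setT _)) (card_le_eql Fd).
Qed.
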